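(* Let $R$ be a commutative ring with identity. The following statements are equivalent: (1) The ring $R$ is a $\Pi_2$ ring. (2) Each matrix in $Um(\mathbb{M}_2(R))$ of zero determinant is non-full, i.e., is the product of two matrices of sizes $2\times 1$ and $1\times 2$ with entries in $R$ (equivalently, the $R$-linear map $L_A:R^2\to R^2$ defined by such a matrix $A$ factors as a composite $R$-linear map $R^2\to R\to R^2$). (3) For each matrix $A\in Um(\mathbb{M}_2(R))$ of zero determinant, one (hence both) of the $R$-modules $\mathrm{Ker}_A$ and $\mathrm{Im}_A$ is isomorphic to $R$. (4) Each projective $R$-module of rank $1$ generated by two elements is isomorphic to $R$.
   Context: A matrix in $\mathbb{M}_2(R)$ is unimodular if its four entries generate the unit ideal of $R$; $Um(\mathbb{M}_2(R))$ is the set of unimodular $2\times 2$ matrices. A matrix $A\in\mathbb{M}_2(R)$ is extendable if there exists $A^+\in SL_3(R)$ whose upper-left $2\times 2$ block (obtained by removing the third row and third column) is $A$. $R$ is a $\Pi_2$ ring if each $A\in Um(\mathbb{M}_2(R))$ with $\det(A)=0$ is extendable. For $A\in\mathbb{M}_2(R)$, $L_A:R^2\to R^2$ is the $R$-linear map defined by $A$ (acting on columns), and $\mathrm{Ker}_A$, $\mathrm{Im}_A$ are its kernel and image. *)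

(* Defs.v *)
From HB Require Import structures.
From mathcomp Require Import all_boot all_algebra.
From mathcomp Require Import ring boolp.

Set Implicit Arguments.
Unset Strict Implicit.
Unset Printing Implicit Defensive.

Import GRing.Theory.
Local Open Scope ring_scope.
Local Open Scope quotient_scope.

(* Rings are [comPzRingType], so the zero ring is allowed.  The ring R seen    *)
(* as a module over itself is R^o, and R^n is 'cV[R]_n.                        *)

Section Modules.
Variable R : pzRingType.

Definition lmod_iso (U V : lmodType R) : Prop :=
  exists f : {linear U -> V}, bijective f.

Definition projective (P : lmodType R) : Prop :=
  forall (M N : lmodType R) (f : {linear M -> N}) (g : {linear P -> N}),
    (forall y, exists x, f x = y) ->
  exists h : {linear P -> M}, forall z, f (h z) = g z.

Definition generated_by_two (P : lmodType R) : Prop :=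
  exists x y : P, forall z : P, exists a b : R, z = a *: x + b *: y.

End Modules.

Section KerIm.
Variables (R : pzRingType) (U V : lmodType R) (f : {linear U -> V}).

Definition in_ker : {pred U} := fun x => f x == 0.
Definition in_im : {pred V} := fun y => `[< exists x, f x = y >].

Lemma in_ker_submod : submod_closed in_ker.
Proof.
split; first by rewrite unfold_in raddf0.
move=> a x y; rewrite !unfold_in => /eqP fx /eqP fy.
by rewrite linearP fx fy scaler0 addr0.
Qed.
HB.instance Definition _ := GRing.isSubmodClosed.Build R U in_ker in_ker_submod.

Lemma in_im_submod : submod_closed in_im.
Proof.
split; first by apply/asboolP; exists 0; rewrite raddf0.
move=> a x y /asboolP[x' <-] /asboolP[y' <-].
by apply/asboolP; exists (a *: x' + y'); rewrite linearP.
Qed.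
HB.instance Definition _ := GRing.isSubmodClosed.Build R V in_im in_im_submod.

Record ker := KerElt { ker_val : U; _ : ker_val \in in_ker }.
HB.instance Definition _ := [isSub for ker_val].
HB.instance Definition _ := [Choice of ker by <:].
HB.instance Definition _ := [SubChoice_isSubZmodule of ker by <:].
HB.instance Definition _ := [SubZmodule_isSubLmodule of ker by <:].

Record im := ImElt { im_val : V; _ : im_val \in in_im }.
HB.instance Definition _ := [isSub for im_val].
HB.instance Definition _ := [Choice of im by <:].
HB.instance Definition _ := [SubChoice_isSubZmodule of im by <:].
HB.instance Definition _ := [SubZmodule_isSubLmodule of im by <:].

End KerIm.

Section Localization.
Variables (R : comPzRingType) (S : mulrClosed R).

Record denom := Denom { denom_val :> R; _ : denom_val \in S }.
HB.instance Definition _ := [isSub for denom_val].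
HB.instance Definition _ := [Choice of denom by <:].

Lemma denomP (s : denom) : (s : R) \in S. Proof. by case: s. Qed.

Definition denom1 : denom := Denom (rpred1 S).
Definition denomM (s t : denom) : denom := Denom (rpredM (denomP s) (denomP t)).

Section Module.
Variable M : lmodType R.

(* S^-1 M: (m, s), standing for m / s, is identified with (n, t) iff            *)
(* u (t m - s n) = 0 for some u in S.                                         *)
Definition frac_equiv (x y : M * denom) : bool :=
  `[< exists u : denom,
        (u : R) *: ((y.2 : R) *: x.1) = (u : R) *: ((x.2 : R) *: y.1) >].

Lemma frac_equiv_refl : reflexive frac_equiv.
Proof. by move=> x; apply/asboolP; exists denom1. Qed.

Lemma frac_equiv_sym : symmetric frac_equiv.
Proof. by move=> x y; apply/asboolP/asboolP=> -[u e]; exists u. Qed.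

Lemma frac_equiv_trans : transitive frac_equiv.
Proof.
move=> [n t] [m s] [k r] /asboolP[u /= e1] /asboolP[v /= e2].
apply/asboolP; exists (denomM (denomM u v) t) => /=.
have -> : ((u : R) * (v : R) * (t : R)) *: ((r : R) *: m)
        = ((v : R) * (r : R)) *: ((u : R) *: ((t : R) *: m)).
  by rewrite !scalerA; congr (_ *: _); ring.
have -> : ((u : R) * (v : R) * (t : R)) *: ((s : R) *: k)
        = ((u : R) * (s : R)) *: ((v : R) *: ((t : R) *: k)).
  by rewrite !scalerA; congr (_ *: _); ring.
by rewrite e1 -e2 !scalerA; congr (_ *: _); ring.
Qed.

Canonical frac_equiv_rel :=
  EquivRel frac_equiv frac_equiv_refl frac_equiv_sym frac_equiv_trans.

Definition localized := {eq_quot frac_equiv}.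
HB.instance Definition _ : EqQuotient _ frac_equiv localized :=
  EqQuotient.on localized.
HB.instance Definition _ := Choice.on localized.

Definition frac (m : M) (s : denom) : localized := \pi_localized (m, s).

Lemma frac_eqP (m n : M) (s t : denom) :
  (exists u : denom, (u : R) *: ((t : R) *: m) = (u : R) *: ((s : R) *: n)) <->
  frac m s = frac n t.
Proof.
split=> [e|]; first by apply/eqmodP/asboolP.
by move/eqmodP/asboolP.
Qed.

Lemma fracE (x : localized) : x = frac (repr x).1 (repr x).2.
Proof. by rewrite /frac -surjective_pairing reprK. Qed.

Definition loc_zero : localized := frac 0 denom1.
Definition loc_opp (x : localized) : localized :=
  frac (- (repr x).1) (repr x).2.
Definition loc_add (x y : localized) : localized :=
  let: (m, s) := repr x in let: (n, t) := repr y in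
  frac ((t : R) *: m + (s : R) *: n) (denomM s t).

Lemma repr_frac (m : M) (s : denom) : exists u : denom,
  (u : R) *: ((s : R) *: (repr (frac m s)).1) =
  (u : R) *: (((repr (frac m s)).2 : R) *: m).
Proof. by apply/frac_eqP; rewrite -fracE. Qed.

Lemma loc_oppE m s : loc_opp (frac m s) = frac (- m) s.
Proof.
have [u e] := repr_frac m s; apply/frac_eqP; exists u.
by rewrite !scalerN e.
Qed.

Lemma loc_addE m s n t : loc_add (frac m s) (frac n t) =
  frac ((t : R) *: m + (s : R) *: n) (denomM s t).
Proof.
rewrite /loc_add; have [u] := repr_frac m s; have [v] := repr_frac n t.
case: (repr _) => n' t' /=; case: (repr _) => m' s' /= e2 e1.
apply/frac_eqP; exists (denomM u v) => /=; rewrite !scalerDr.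
congr (_ + _).
  transitivity (((v : R) * (t : R) * (t' : R)) *: ((u : R) *: ((s : R) *: m'))).
    by rewrite !scalerA; congr (_ *: _); ring.
  by rewrite e1 !scalerA; congr (_ *: _); ring.
transitivity (((u : R) * (s : R) * (s' : R)) *: ((v : R) *: ((t : R) *: n'))).
  by rewrite !scalerA; congr (_ *: _); ring.
by rewrite e2 !scalerA; congr (_ *: _); ring.
Qed.

Lemma frac_eq (m n : M) (s t : denom) :
  (t : R) *: m = (s : R) *: n -> frac m s = frac n t.
Proof. by move=> e; apply/frac_eqP; exists denom1; rewrite e. Qed.

Lemma loc_addA : associative loc_add.
Proof.
move=> x y z; rewrite [x]fracE [y]fracE [z]fracE !loc_addE.
apply: frac_eq => /=; rewrite !(scalerDr, scalerA).
by rewrite addrA; congr (_ + _ + _); congr (_ *: _); ring.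
Qed.

Lemma loc_addC : commutative loc_add.
Proof.
move=> x y; rewrite [x]fracE [y]fracE !loc_addE.
apply: frac_eq => /=; rewrite !(scalerDr, scalerA) addrC.
by congr (_ + _); congr (_ *: _); ring.
Qed.

Lemma loc_add0 : left_id loc_zero loc_add.
Proof.
move=> x; rewrite [x]fracE loc_addE; apply: frac_eq => /=.
by rewrite scaler0 add0r !scalerA; congr (_ *: _); ring.
Qed.

Lemma loc_addN : left_inverse loc_zero loc_opp loc_add.
Proof.
move=> x; rewrite [x]fracE loc_oppE loc_addE; apply: frac_eq => /=.
by rewrite scalerN addNr !scaler0.
Qed.

HB.instance Definition _ :=
  GRing.isZmodule.Build localized loc_addA loc_addC loc_add0 loc_addN.

Lemma frac_add m s n t : frac m s + frac n t =
  frac ((t : R) *: m + (s : R) *: n) (denomM s t).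
Proof. exact: loc_addE. Qed.

End Module.

Definition loc_scale (M : lmodType R) (a : localized R^o) (x : localized M) :
    localized M :=
  let: (r, s) := repr a in let: (m, t) := repr x in
  frac ((r : R) *: m) (denomM s t).

Lemma loc_scaleE (M : lmodType R) (r : R^o) (s : denom) (m : M) (t : denom) :
  loc_scale (frac r s) (frac m t) = frac ((r : R) *: m) (denomM s t).
Proof.
rewrite /loc_scale; have [u] := repr_frac r s; have [v] := repr_frac m t.
case: (repr _) => m' t' /=; case: (repr _) => r' s' /= e2 e1.
apply/frac_eqP; exists (denomM u v) => /=.
transitivity (((u : R) * ((s : R) * (r' : R))) *: ((v : R) *: ((t : R) *: m'))).
  by rewrite !scalerA; congr (_ *: _); ring.
have {}e1 : (u : R) * ((s : R) * (r' : R)) = (u : R) * ((s' : R) * (r : R)) := e1.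
by rewrite e1 e2 !scalerA; congr (_ *: _); ring.
Qed.

(* S^-1 R is the localization of the module R^o; its product is the case      *)
(* M := R^o of the action of S^-1 R on S^-1 M.                                *)
Definition loc_ring := localized R^o.
HB.instance Definition _ := GRing.Zmodule.on loc_ring.

Definition loc_one : loc_ring := frac (1 : R^o) denom1.
Definition loc_mul (a b : loc_ring) : loc_ring := loc_scale a b.

Section Scale.
Variable M : lmodType R.

Lemma loc_scaleA (a b : loc_ring) (x : localized M) :
  loc_scale a (loc_scale b x) = loc_scale (loc_mul a b) x.
Proof.
rewrite /loc_mul [a]fracE [b]fracE [x]fracE !loc_scaleE; apply: frac_eq => /=.
by rewrite !scalerA; congr (_ *: _); rewrite /GRing.scale /=; ring.
Qed.

Lemma loc_scale1 : left_id loc_one (@loc_scale M).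
Proof.
move=> x; rewrite [x]fracE loc_scaleE; apply: frac_eq => /=.
by rewrite !scalerA; congr (_ *: _); ring.
Qed.

Lemma loc_scaleDr (a : loc_ring) (x y : localized M) :
  loc_scale a (x + y) = loc_scale a x + loc_scale a y.
Proof.
rewrite [a]fracE [x]fracE [y]fracE frac_add !loc_scaleE frac_add.
apply: frac_eq => /=; rewrite !(scalerDr, scalerA).
by congr (_ + _); congr (_ *: _); ring.
Qed.

Lemma loc_scaleDl (x : localized M) (a b : loc_ring) :
  loc_scale (a + b) x = loc_scale a x + loc_scale b x.
Proof.
rewrite [a]fracE [b]fracE [x]fracE frac_add !loc_scaleE frac_add.
apply: frac_eq => /=.
have -> : ((repr b).2 : R) *: (repr a).1 + ((repr a).2 : R) *: (repr b).1 =
  ((repr b).2 : R) * ((repr a).1 : R) + ((repr a).2 : R) * ((repr b).1 : R) by [].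
rewrite scalerA !scalerDr !scalerA -scalerDl; congr (_ *: _); ring.
Qed.

End Scale.

Lemma loc_mulA : associative loc_mul.
Proof. by move=> a b c; apply: loc_scaleA. Qed.

Lemma loc_mulC : commutative loc_mul.
Proof.
move=> a b; rewrite /loc_mul [a]fracE [b]fracE !loc_scaleE; apply: frac_eq => /=.
by rewrite /GRing.scale /=; ring.
Qed.

Lemma loc_mulDl : left_distributive loc_mul +%R.
Proof. by move=> a b c; apply: loc_scaleDl. Qed.

HB.instance Definition _ := GRing.Zmodule_isComPzRing.Build loc_ring
  loc_mulA loc_mulC (@loc_scale1 R^o) loc_mulDl.

HB.instance Definition _ (M : lmodType R) :=
  GRing.Zmodule_isLmodule.Build loc_ring (localized M)
    (@loc_scaleA M) (@loc_scale1 M) (@loc_scaleDr M) (@loc_scaleDl M).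

End Localization.

Section Rank.
Variable R : comPzRingType.

Record prime_ideal := PrimeIdeal {
  prime_mem :> {pred R};
  _ : 0 \in prime_mem;
  _ : {in prime_mem &, forall x y, x + y \in prime_mem};
  _ : forall a, {in prime_mem, forall x, a * x \in prime_mem};
  _ : 1 \notin prime_mem;
  _ : forall x y, x * y \in prime_mem -> (x \in prime_mem) || (y \in prime_mem)
}.

Definition prime_compl (p : prime_ideal) : {pred R} := [pred x | x \notin p].

Lemma prime_compl_mulr_closed (p : prime_ideal) :
  GRing.mulr_closed (prime_compl p).
Proof.
case: p => p ? ? ? p1 pM; split=> // x y; rewrite !inE /= => px py.
by apply/negP => /pM; rewrite (negPf px) (negPf py).
Qed.

HB.instance Definition _ (p : prime_ideal) :=
  GRing.isMulClosed.Build R (prime_compl p) (prime_compl_mulr_closed p).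

(* Rank in the sense of Spec R: P_p is free over R_p of rank n at every p.     *)
Definition has_rank (P : lmodType R) (n : nat) : Prop :=
  forall p : prime_ideal,
    @lmod_iso (loc_ring (prime_compl p)) (localized (prime_compl p) P)
      'cV[loc_ring (prime_compl p)]_n.

End Rank.

Section Matrices.
Variable R : comPzRingType.

(* The entries generate the unit ideal: 1 is a linear combination of them.    *)
Definition unimodular (m n : nat) (A : 'M[R]_(m, n)) : Prop :=
  exists C : 'M[R]_(m, n), \sum_i \sum_j C i j * A i j = 1.

Definition extendable (A : 'M[R]_2) : Prop :=
  exists B : 'M[R]_3, \det B = 1 /\ row' ord_max (col' ord_max B) = A.

Definition Pi2_ring : Prop :=
  forall A : 'M[R]_2, unimodular A -> \det A = 0 -> extendable A.

Definition non_full (A : 'M[R]_2) : Prop :=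
  exists (B : 'M[R]_(2, 1)) (C : 'M[R]_(1, 2)), A = B *m C.

Definition lmap (m n : nat) (A : 'M[R]_(m, n)) : {linear 'cV[R]_n -> 'cV[R]_m} :=
  mulmx A.

Definition factors_through_R (U V : lmodType R) (f : {linear U -> V}) : Prop :=
  exists (h : {linear U -> R^o}) (g : {linear R^o -> V}),
    forall x, f x = g (h x).

End Matrices.

(* Main.v *)
From HB Require Import structures.
From mathcomp Require Import all_boot all_algebra.
From mathcomp Require Import ring boolp classical_sets.
Require Import Defs.

(** The equivalences rest on one identity: a 2 x 2 matrix A of zero determinant
    satisfies A N A = tr(N A) A for every N ([det0_mul_mulmx]).

    Unimodularity of A says that tr(N A) = 1 for some N, so that A N A = A: then
    N A is idempotent of trace 1, and R^2 is the direct sum of Ker_A and of a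
    copy of Im_A. Moreover both extendability (expand the determinant of a
    bordered matrix, [det_bordered]) and non-fullness (A = (A x)(y A) when
    y A x = 1) are equivalent to the solvability of y A x = 1 in a row y and a
    column x ([extendableP], [non_fullP]). This is the equivalence of the first
    two statements.

    If A = B C is unimodular, then so are the column B and the row C; hence Im_A
    is freely generated by B, and Ker_A, the kernel of C, is freely generated by
    C turned by a right angle. Conversely, an isomorphism of Im_A with R factors
    A through R, and an isomorphism of Ker_A with R factors 1 - N A through R;
    since N A has trace 1, it is the adjugate of 1 - N A, so it is non-full as
    well, and so is A = A (N A) ([non_full_im], [non_full_ker]).

    A projective module P with two generators is the image of an idempotent E of
    size 2. Suppose that P has rank 1. Near each prime P has a single generator,
    so a multiple u E with u outside the prime is an outer product; this forces
    det E = 0 and, as P is locally faithful, tr E = 1. Both equalities are local,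
    because the annihilator of a nonzero element is contained in a prime ideal
    ([local_eq0]). So E is unimodular of zero determinant, and a factorization of
    E gives an isomorphism of P with R. Conversely, for A unimodular of zero
    determinant, Im_A is projective with two generators, and it has rank 1
    because at each prime some entry of A is invertible and the column of that
    entry is then a basis of the localized module ([im_rank1]). *)

Set Implicit Arguments.
Unset Strict Implicit.
Unset Printing Implicit Defensive.

Import GRing.Theory.
Local Open Scope ring_scope.

(** * Two by two matrices of zero determinant *)

Section TwoByTwo.
Variable R : comPzRingType.
Implicit Types A B : 'M[R]_2.

Lemma sum2E (V : nmodType) (F : 'I_2 -> V) : \sum_i F i = F 0 + F 1.
Proof.
by rewrite !big_ord_recl big_ord0 addr0; congr (_ + F _); apply/val_inj.
Qed.

Lemma det2E A : \det A = A 0 0 * A 1 1 - A 0 1 * A 1 0.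
Proof.
pose a (i j : nat) := A (inord i) (inord j).
have aE i j : A i j = a i j by rewrite /a !inord_val.
rewrite (expand_det_row _ 0) sum2E /cofactor !det_mx11 !mxE !aE /=.
rewrite /bump /=; ring.
Qed.

(** With A bordered by a column u, a row v and a corner w, this is
    w det A - v adj(A) u. *)
Lemma det_bordered (B : 'M[R]_3) (A := row' ord_max (col' ord_max B)) :
  \det B = B ord_max ord_max * \det A
    - (B ord_max 0 * (A 1 1 * B 0 ord_max - A 0 1 * B 1 ord_max)
       + B ord_max 1 * (A 0 0 * B 1 ord_max - A 1 0 * B 0 ord_max)).
Proof.
pose b (i j : nat) := B (inord i) (inord j).
have bE i j : B i j = b i j by rewrite /b !inord_val.
rewrite (expand_det_row _ ord_max) !big_ord_recl big_ord0 /cofactor !det2E.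
rewrite /A !mxE !bE /= /bump /=; ring.
Qed.

Lemma mul2E m n (B : 'M[R]_(m, 2)) (C : 'M[R]_(2, n)) i j :
  (B *m C) i j = B i 0 * C 0 j + B i 1 * C 1 j.
Proof. by rewrite mxE sum2E. Qed.

Lemma outerE m n (B : 'M[R]_(m, 1)) (C : 'M[R]_(1, n)) i j :
  (B *m C) i j = B i 0 * C 0 j.
Proof. by rewrite mxE big_ord1. Qed.

Lemma ord2P (P : 'I_2 -> Prop) : P 0 -> P 1 -> forall i, P i.
Proof.
by move=> P0 P1 [[|[|//]] ilt]; [move: P0|move: P1]; congr P; apply/val_inj.
Qed.

Lemma det0_mul_mulmx A N : \det A = 0 -> A *m N *m A = \tr (N *m A) *: A.
Proof.
rewrite det2E => /eqP; rewrite subr_eq0 => /eqP e; apply/matrixP.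
apply: ord2P; apply: ord2P; rewrite !mxE sum2E /mxtrace sum2E !mul2E.
all: ring: e.
Qed.

(** By [det_bordered] the determinant of an extension of A is y A x, where x and
    y are, up to signs, the bordering row and column with their entries swapped;
    the corner entry is irrelevant. *)
Lemma extendableP A : \det A = 0 ->
  extendable A <-> exists (y : 'rV_2) (x : 'cV_2), (y *m A *m x) 0 0 = 1.
Proof.
move=> A0; split=> [[B [B1 BA]]|[y [x e]]].
  exists (\row_j if j == 0 then B 1 ord_max else - B 0 ord_max).
  exists (\col_i if i == 0 then - B ord_max 1 else B ord_max 0).
  by rewrite -B1 det_bordered BA A0 !mul2E !mxE /=; ring.
pose b := [:: [:: A 0 0; A 0 1; - y 0 1]; [:: A 1 0; A 1 1; y 0 0];
           [:: x 1 0; - x 0 0; 0]].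
pose B := \matrix_(i < 3, j < 3) nth 0 (nth [::] b i) j.
have BA : row' ord_max (col' ord_max B) = A.
  by apply/matrixP; apply: ord2P; apply: ord2P; rewrite !mxE.
exists B; split=> //; rewrite det_bordered BA A0 !mxE /= -e !mul2E; ring.
Qed.

Lemma trace_unimodular m n (A : 'M[R]_(m, n)) :
  unimodular A <-> exists N : 'M_(n, m), \tr (N *m A) = 1.
Proof.
split=> [[C e]|[N e]].
  exists C^T; rewrite -e /mxtrace exchange_big; apply: eq_bigr => i _.
  by rewrite mxE; apply: eq_bigr => j _; rewrite mxE.
exists N^T; rewrite -e /mxtrace exchange_big; apply: eq_bigr => i _.
by rewrite mxE; apply: eq_bigr => j _; rewrite mxE.
Qed.

Lemma trace_mul1 n (B : 'cV[R]_n) (C : 'rV[R]_n) :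
  \tr (B *m C) = (C *m B) 0 0.
Proof. by rewrite mxtrace_mulC /mxtrace big_ord1. Qed.

Lemma unimodular_outer m n (B : 'M[R]_(m, 1)) (C : 'M[R]_(1, n)) :
  unimodular (B *m C) ->
  exists (y : 'rV_m) (x : 'cV_n), y *m B = 1%:M /\ C *m x = 1%:M.
Proof.
case/trace_unimodular=> N; rewrite mulmxA trace_mul1 => e.
have e1 : C *m (N *m B) = 1%:M by rewrite [LHS]mx11_scalar e.
by exists (C *m N), (N *m B); rewrite -mulmxA.
Qed.

Lemma non_fullP A : unimodular A -> \det A = 0 ->
  non_full A <-> exists (y : 'rV_2) (x : 'cV_2), (y *m A *m x) 0 0 = 1.
Proof.
move=> uA A0; split=> [[B [C e]]|[y [x e]]].
  move: uA; rewrite e => /unimodular_outer[y [x [yB Cx]]].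
  by exists y, x; rewrite mulmxA yB mul1mx Cx mxE.
exists (A *m x), (y *m A).
by rewrite mulmxA -(mulmxA A) (det0_mul_mulmx _ A0) -mulmxA trace_mul1 e scale1r.
Qed.

(** A matrix E of trace 1 is the adjugate of 1 - E, and the adjugate of an outer
    product B C is again an outer product. *)
Lemma non_full_compl (E : 'M[R]_2) :
  \tr E = 1 -> non_full (1%:M - E) -> non_full E.
Proof.
rewrite /mxtrace sum2E => e [B [C /matrixP F]].
exists (\col_i (if i == 0 then - C 0 1 else C 0 0)).
exists (\row_j (if j == 0 then - B 1 0 else B 0 0)).
have := F 0 0; have := F 0 1; have := F 1 0; have := F 1 1.
rewrite !outerE !mxE /= => f11 f10 f01 f00.
apply/matrixP; apply: ord2P; apply: ord2P; rewrite !outerE !mxE /=.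
- by transitivity (B 1 0 * C 0 1); [rewrite -f11 -e | ]; ring.
- by transitivity (- (B 0 0 * C 0 1)); [rewrite -f01 | ]; ring.
- by transitivity (- (B 1 0 * C 0 0)); [rewrite -f10 | ]; ring.
- by transitivity (B 0 0 * C 0 0); [rewrite -f00 -e | ]; ring.
Qed.

Lemma non_full_mul (A N : 'M[R]_2) : non_full N -> non_full (A *m N).
Proof. by case=> B [C ->]; exists (A *m B), C; rewrite mulmxA. Qed.

End TwoByTwo.

(** * Linear maps, isomorphisms and projective modules *)

Section Isomorphisms.
Variable R : pzRingType.
Implicit Types U V : lmodType R.

Lemma inj_surj_bij (T T' : Type) (f : T -> T') :
  injective f -> (forall y, exists x, f x = y) -> bijective f.
Proof.
move=> f_inj f_surj; pose g y := projT1 (cid (f_surj y)).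
have gK : cancel g f by move=> y; rewrite /g; case: cid.
by exists g => // x; apply: f_inj; rewrite gK.
Qed.

Lemma bij_linear_inv U V (f : {linear U -> V}) : bijective f ->
  exists g : {linear V -> U}, cancel f g /\ cancel g f.
Proof.
case=> g fK gK.
pose gl := HB.pack_for {linear V -> U} g
  (GRing.isLinear.Build R V U _ g (can2_linear fK gK)).
by exists gl.
Qed.

Lemma lmod_iso_sym U V : lmod_iso U V -> lmod_iso V U.
Proof.
case=> f /bij_linear_inv[g [fK gK]].
by exists g; exists f.
Qed.

Lemma ext_linear U V (f : U -> V) : linear f ->
  exists g : {linear U -> V}, g =1 f.
Proof.
move=> f_lin.
by exists (HB.pack_for {linear U -> V} f (GRing.isLinear.Build R U V _ f f_lin)).
Qed.

Lemma linear_iso U V (f : U -> V) : linear f ->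
  (forall x, f x = 0 -> x = 0) -> (forall y, exists x, f x = y) -> lmod_iso U V.
Proof.
move=> /ext_linear[g gE] f_inj f_surj; exists g; apply: inj_surj_bij.
  move=> x y e; apply/eqP; rewrite -subr_eq0.
  by apply/eqP/f_inj; rewrite -gE linearB e subrr.
by move=> y; have [x <-] := f_surj y; exists x.
Qed.

Lemma scaler_linear V (v : V) : linear (fun r : R^o => (r : R) *: v).
Proof. by move=> a r s; rewrite scalerDl scalerA. Qed.

(** Dual basis criterion: the elements e_i and the forms l_i form a dual basis. *)
Lemma dual_basis_projective (P : lmodType R) n (e : 'I_n -> P)
    (l : 'I_n -> {linear P -> R^o}) :
  (forall z, z = \sum_i (l i z : R) *: e i) -> projective P.
Proof.
move=> dual M N f g f_surj; pose m i := projT1 (cid (f_surj (g (e i)))).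
have fm i : f (m i) = g (e i) by rewrite /m; case: cid.
have [|h hE] := @ext_linear P M (fun z => \sum_i (l i z : R) *: m i).
  move=> a x y; rewrite scaler_sumr -big_split /=; apply: eq_bigr => i _.
  by rewrite linearP scalerDl scalerA.
exists h => z; rewrite hE [in RHS](dual z) !linear_sum.
by apply: eq_bigr => i _; rewrite !linearZ fm.
Qed.

End Isomorphisms.

(** * Kernel, image and non-full matrices *)

Section KernelImage.
Variable R : comPzRingType.
Implicit Type A : 'M[R]_2.

Lemma mulmx_inj m n (A B : 'M[R]_(m, n)) :
  (forall z : 'cV_n, A *m z = B *m z) -> A = B.
Proof.
move=> e; apply/matrixP => i j.
have /matrixP/(_ i 0) := e (delta_mx j 0).
by rewrite -!colE !mxE.
Qed.

Lemma non_full_factors A : non_full A <-> factors_through_R (lmap A).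
Proof.
split=> [[B [C ->]]|[h [g e]]].
  have [|h hE] := @ext_linear _ 'cV[R]_2 R^o (fun z => (C *m z) 0 0).
    by move=> a x y; rewrite linearP !mxE.
  have [g gE] := ext_linear (scaler_linear B).
  exists h, g => x; rewrite hE gE /= -mulmxA.
  by rewrite {1}[C *m x]mx11_scalar mul_mx_scalar.
exists (g (1 : R^o)), (\row_j h (delta_mx j 0)); apply: mulmx_inj => z.
have -> : A *m z = g (h z) by apply: e.
have {1}-> : z = \sum_j z j 0 *: delta_mx j 0.
  by rewrite [LHS]matrix_sum_delta; apply: eq_bigr => i _; rewrite big_ord1.
rewrite -mulmxA [_ *m z]mx11_scalar mul_mx_scalar mxE !linear_sum scaler_suml.
apply: eq_bigr => j _; rewrite linearZ /= mxE mulrC.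
by rewrite -{1}[h _]mulr1 [X in g X]scalerA linearZ.
Qed.

Lemma im_iso_non_full A : lmod_iso (im (lmap A)) R^o -> non_full A.
Proof.
case=> f /bij_linear_inv[g [fK gK]]; apply/non_full_factors.
have imA z : A *m z \in in_im (lmap A) by apply/asboolP; exists z.
have [|h hE] := @ext_linear _ 'cV[R]_2 R^o (fun z => f (ImElt (imA z))).
  move=> a x y; rewrite -linearP; congr (f _); apply: val_inj.
  by rewrite [RHS]linearP /= mulmxDr -scalemxAr.
have [|k kE] := @ext_linear _ R^o 'cV[R]_2 (fun r => val (g r)).
  by move=> a x y; rewrite !linearP.
by exists h, k => x; rewrite kE hE fK.
Qed.

(** When A N A = A, the matrix 1 - N A maps R^2 into Ker_A, so it factors through
    R as soon as Ker_A is isomorphic to R. *)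
Lemma ker_iso_non_full A N : A *m N *m A = A ->
  lmod_iso (ker (lmap A)) R^o -> non_full (1%:M - N *m A).
Proof.
move=> ANA [f /bij_linear_inv[g [fK gK]]]; apply/non_full_factors.
have kerA z : (1%:M - N *m A) *m z \in in_ker (lmap A).
  by rewrite unfold_in /= mulmxA mulmxBr mulmx1 mulmxA ANA subrr mul0mx.
have [|h hE] := @ext_linear _ 'cV[R]_2 R^o (fun z => f (KerElt (kerA z))).
  move=> a x y; rewrite -linearP; congr (f _); apply: val_inj.
  by rewrite [RHS]linearP /= mulmxDr -scalemxAr.
have [|k kE] := @ext_linear _ R^o 'cV[R]_2 (fun r => val (g r)).
  by move=> a x y; rewrite !linearP.
by exists h, k => x; rewrite kE hE fK.
Qed.

Lemma non_full_im_iso A :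
  unimodular A -> non_full A -> lmod_iso (im (lmap A)) R^o.
Proof.
move=> uA [B [C e]]; move: uA; rewrite {}e => /unimodular_outer[y [x [yB Cx]]].
apply: lmod_iso_sym.
have imB (r : R) : r *: B \in in_im (lmap (B *m C)).
  by apply/asboolP; exists (r *: x); rewrite /= -scalemxAr -mulmxA Cx mulmx1.
apply: (@linear_iso _ R^o _ (fun r => ImElt (imB r))).
- move=> a r s; apply: val_inj.
  by rewrite [RHS]linearP /= scalerDl scalerA.
- move=> r /(congr1 val) /= /(congr1 (mulmx y)) /matrixP/(_ 0 0).
  by rewrite -scalemxAr yB mulmx0 !mxE mulr1.
case=> z /[dup] /asboolP[t /= tz] iz; exists ((C *m t) 0 0).
by apply: val_inj; rewrite /= -tz -mulmxA {2}[C *m t]mx11_scalar mul_mx_scalar.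
Qed.

Lemma non_full_ker_iso A :
  unimodular A -> non_full A -> lmod_iso (ker (lmap A)) R^o.
Proof.
move=> uA [B [C e]]; move: uA; rewrite {}e => /unimodular_outer[y [x [yB Cx]]].
apply: lmod_iso_sym.
(* The generator v is orthogonal to the row C, and conversely a vector z
   orthogonal to C is a multiple of v, by the determinant of (x, z). *)
pose v : 'cV[R]_2 := \col_i (if i == 0 then - C 0 1 else C 0 0).
have Cv : C *m v = 0.
  by apply/matrixP=> i j; rewrite !ord1 mul2E !mxE /=; ring.
have C1 : C 0 0 * x 0 0 + C 0 1 * x 1 0 = 1 by rewrite -mul2E Cx mxE.
have kerv (r : R) : r *: v \in in_ker (lmap (B *m C)).
  by rewrite unfold_in /= -scalemxAr -mulmxA Cv mulmx0 scaler0.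
apply: (@linear_iso _ R^o _ (fun r => KerElt (kerv r))).
- move=> a r s; apply: val_inj.
  by rewrite [RHS]linearP /= scalerDl scalerA.
- move=> r /(congr1 val) /= /matrixP rv.
  have := rv 0 0; have := rv 1 0; rewrite !mxE /= => r0 r1.
  transitivity (r * C 0 0 * x 0 0 - r * - C 0 1 * x 1 0).
    by rewrite -[LHS]mulr1 -C1; ring.
  by rewrite r0 r1 !mul0r subr0.
case=> z iz; have zC : C 0 0 * z 0 0 + C 0 1 * z 1 0 = 0.
  move: (iz); rewrite unfold_in /= => /eqP/(congr1 (mulmx y))/matrixP/(_ 0 0).
  by rewrite !mulmxA yB mul1mx mulmx0 mul2E !mxE.
exists (z 1 0 * x 0 0 - z 0 0 * x 1 0); apply: val_inj => /=.
apply/matrixP => i j; rewrite ord1; move: i; apply: ord2P; rewrite !mxE /=.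
  rewrite -[RHS]mulr1 -C1.
  transitivity (z 0 0 * (C 0 0 * x 0 0 + C 0 1 * x 1 0) -
    x 0 0 * (C 0 0 * z 0 0 + C 0 1 * z 1 0)); last by rewrite zC; ring.
  ring.
rewrite -[RHS]mulr1 -C1.
transitivity (z 1 0 * (C 0 0 * x 0 0 + C 0 1 * x 1 0) -
    x 1 0 * (C 0 0 * z 0 0 + C 0 1 * z 1 0)); last by rewrite zC; ring.
ring.
Qed.

Lemma unimodular_inner_inverse A : unimodular A -> \det A = 0 ->
  exists N, A *m N *m A = A /\ \tr (N *m A) = 1.
Proof.
move=> /trace_unimodular[N N1] A0; exists N; split=> //.
by rewrite det0_mul_mulmx // N1 scale1r.
Qed.

Lemma non_full_im A : unimodular A ->
  non_full A <-> lmod_iso (im (lmap A)) R^o.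
Proof.
by move=> uA; split; [apply: non_full_im_iso | apply: im_iso_non_full].
Qed.

Lemma non_full_ker A : unimodular A -> \det A = 0 ->
  non_full A <-> lmod_iso (ker (lmap A)) R^o.
Proof.
move=> uA A0; split; first exact: non_full_ker_iso.
have [N [ANA N1]] := unimodular_inner_inverse uA A0.
move/(ker_iso_non_full ANA)/(non_full_compl N1).
by move/(non_full_mul A); rewrite mulmxA ANA.
Qed.

End KernelImage.

(** * Prime ideals and local equalities *)

Section PrimeIdeals.
Variable R : comPzRingType.

(** Proper ideals as classical sets; [prime_ideal] is a bundle of the same
    conditions on a Boolean predicate together with primality. *)
Definition proper_ideal (I : set R) : Prop :=
  [/\ I 0, forall x y, I x -> I y -> I (x + y),
      forall a x, I x -> I (a * x) & ~ I 1].

Lemma proper_ideal_sub_maximal (J : set R) : proper_ideal J ->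
  exists M : set R, [/\ proper_ideal M, (J `<=` M)%classic &
    forall I, proper_ideal I -> (M `<=` I)%classic -> (I `<=` M)%classic].
Proof.
(* The union of the empty chain must satisfy the property given to Zorn's
   lemma, so this property only asks that I become a proper ideal after taking
   its union with J. *)
move=> Jp; pose P (I : set R) := proper_ideal (I `|` J)%classic.
have [|M [MP Mmax]] := @Zorn_bigcup R P.
  move=> F FP Ftot; rewrite /P; have [J0 JD JM J1] := Jp.
  split; first by right.
  - move=> x y [[X FX Xx]|Jx] [[Y FY Yy]|Jy]; last by right; apply: JD.
    + wlog XY : x y X Y FX Xx FY Yy / (X `<=` Y)%classic.
        move=> W; have [XY|YX] := Ftot _ _ FX FY; first exact: (W x y X Y).
        by rewrite addrC; apply: (W y x Y X).
      have [_ D _ _] := FP _ FY.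
      by have [Z|Z] := D x y (or_introl (XY _ Xx)) (or_introl Yy);
        [left; exists Y | right].
    + have [_ D _ _] := FP _ FX.
      by have [Z|Z] := D x y (or_introl Xx) (or_intror Jy);
        [left; exists X | right].
    + have [_ D _ _] := FP _ FY.
      by have [Z|Z] := D x y (or_intror Jx) (or_introl Yy);
        [left; exists Y | right].
  - move=> a x [[X FX Xx]|Jx]; last by right; apply: JM.
    have [_ _ D _] := FP _ FX.
    by have [Z|Z] := D a x (or_introl Xx); [left; exists X | right].
  - by case=> // -[X FX X1]; have [_ _ _ []] := FP _ FX; left.
exists (M `|` J)%classic; split=> // I Ip MI x Ix.
left; apply: contrapT => Mx; apply: (Mmax I).
  split; first by move=> y My; apply: MI; left.
  by move/(_ x Ix).
rewrite /P (_ : (I `|` J)%classic = I) //.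
by apply/seteqP; split=> y; [case=> // Jy; apply: MI; right | left].
Qed.

Lemma proper_ideal_sub_prime (J : set R) : proper_ideal J ->
  exists p : prime_ideal R, forall x, J x -> x \in p.
Proof.
case/proper_ideal_sub_maximal=> M [[M0 MD MM M1] JM Mmax].
unshelve eexists (@PrimeIdeal R [pred x | `[< M x >]] _ _ _ _ _).
- exact/asboolP.
- by move=> x y /asboolP Mx /asboolP My; apply/asboolP/MD.
- by move=> a x /asboolP Mx; apply/asboolP/MM.
- exact/asboolPn.
- move=> x y /asboolP Mxy; apply/orP.
  case: (pselect (M x)) => Mx; first by left; apply/asboolP.
  right; apply/asboolP; apply: contrapT => My.
  (* The ideal M + R x contains x, which is not in M, so it is not proper. *)
  pose I : set R := fun z => exists2 m, M m & exists a, z = m + a * x.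
  have MI : (M `<=` I)%classic by move=> m Mm; exists m => //; exists 0; ring.
  have Ix : I x by exists 0 => //; exists 1; ring.
  apply: Mx; apply: (Mmax I) => //; split.
  + exact: MI.
  + move=> _ _ [m Mm [a ->]] [n Mn [b ->]].
    by exists (m + n); [apply: MD | exists (a + b); ring].
  + move=> c _ [m Mm [a ->]].
    by exists (c * m); [apply: MM | exists (c * a); ring].
  + case=> m Mm [a e]; apply: My.
    have -> : y = y * m + a * (x * y).
      by rewrite -{1}[y]mulr1 e; ring.
    by apply: MD; apply: MM.
by move=> x /JM Mx; apply/asboolP.
Qed.

Lemma local_eq0 (x : R) :
  (forall p : prime_ideal R, exists2 u, u \notin p & u * x = 0) -> x = 0.
Proof.
move=> xloc; apply: contrapT => x0.
have [|p pP] := @proper_ideal_sub_prime (fun a => a * x = 0).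
  split=> [|a b ax bx|a b bx|]; first exact: mul0r.
  - by rewrite mulrDl ax bx addr0.
  - by rewrite -mulrA bx mulr0.
  - by rewrite mul1r.
by have [u /negP up ux] := xloc p; apply: up; apply: pP.
Qed.

End PrimeIdeals.

(** * Modules of rank one *)

Section Rank1.
Variable R : comPzRingType.
Implicit Types (S : mulrClosed R) (P : lmodType R).

Lemma scale_frac S P (r : R^o) (s : denom S) (m : P) (t : denom S) :
  (frac r s : loc_ring S) *: frac m t = frac ((r : R) *: m) (denomM s t).
Proof. exact: loc_scaleE. Qed.

Lemma frac_eq0 S P (m : P) (s : denom S) :
  frac m s = 0 <-> exists2 u : R, u \in S & u *: m = 0.
Proof.
split=> [/frac_eqP[u]|[u uS e]].
  by rewrite scale1r !scaler0 => e; exists (u : R); first exact: denomP.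
by apply/frac_eqP; exists (Denom uS); rewrite scale1r !scaler0.
Qed.

(** If t is in S and t z = l(z) g for all z, where l is a form with l(g) = t, then
    g / 1 is a basis of the localized module, with coordinate map l / t. *)
Lemma localized_free1 S P (g : P) (l : {linear P -> R^o}) (t : R) :
  t \in S -> (l g : R) = t -> (forall z, t *: z = (l z : R) *: g) ->
  @lmod_iso (loc_ring S) (localized S P) 'cV[loc_ring S]_1.
Proof.
move=> tS lg tl; apply: lmod_iso_sym.
apply: (@linear_iso _ 'cV[loc_ring S]_1 (localized S P)
  (fun c => c 0 0 *: (frac g (denom1 S) : localized S P))).
- by move=> a x y; rewrite !mxE scalerDl scalerA.
- move=> c; rewrite {2}[c]mx11_scalar.
  rewrite [c 0 0]fracE scale_frac => /frac_eq0[u uS e].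
  set a := frac _ _; suff -> : a = 0 by rewrite raddf0.
  apply/frac_eq0; exists (u * t); first exact: rpredM.
  have := congr1 l e; rewrite !linearZ raddf0 /= => <-.
  by rewrite /GRing.scale /= lg; ring.
move=> y; exists (const_mx (frac (l (repr y).1) (denomM (Denom tS) (repr y).2))).
rewrite mxE scale_frac {3}[y]fracE; apply: frac_eq => /=.
rewrite -tl !scalerA; congr (_ *: _); ring.
Qed.

Section Local.
Variables (p : prime_ideal R) (P : lmodType R).
Let S := prime_compl p.
Hypothesis iso : @lmod_iso (loc_ring S) (localized S P) 'cV[loc_ring S]_1.

(** The numerator g of a basis of the localized module generates each z of P, up
    to a multiplier outside p. *)
Lemma rank1_local_generator :
  exists g : P, forall z : P,
    exists2 u, u \notin p & exists a : R, u *: z = a *: g.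
Proof.
case: iso => f /bij_linear_inv[h [fK hK]].
pose w := h (const_mx 1); exists (repr w).1 => z.
pose c := f (frac z (denom1 _)) 0 0.
have zw : frac z (denom1 S) = c *: w.
  rewrite /w -linearZ -[LHS]fK; congr (h _); apply/matrixP => i j.
  by rewrite !ord1 !mxE mulr1.
have : frac z (denom1 S) =
    frac (((repr c).1 : R) *: (repr w).1) (denomM (repr c).2 (repr w).2).
  by rewrite zw {1}[c]fracE {1}[w]fracE scale_frac.
case/frac_eqP=> u /=.
rewrite !scale1r !scalerA => e.
pose d := denomM u (denomM (repr c).2 (repr w).2).
exists (d : R); first exact: (denomP d).
exists ((u : R) * (repr c).1); exact: e.
Qed.

Lemma rank1_local_faithful (r : R) :
  (forall z : P, r *: z = 0) -> exists2 u, u \notin p & u * r = 0.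
Proof.
case: iso => f /bij_linear_inv[h [fK hK]] r0.
suff /frac_eq0[u uS e] : frac (r : R^o) (denom1 S) = 0 by exists u.
have : h ((frac (r : R^o) (denom1 S) : loc_ring S) *: const_mx 1) = 0.
  rewrite linearZ /= [h _]fracE scale_frac r0; apply/frac_eq0.
  by exists 1; rewrite ?rpred1 ?scaler0.
move/(congr1 f); rewrite hK linear0 => /matrixP/(_ 0 0); rewrite !mxE mulr1.
exact.
Qed.

End Local.
End Rank1.

(** * Direct summands of rank one in the plane *)

(** Here P is a direct summand of R^2, with projection [pr] and inclusion [s], and
    E is the matrix of the idempotent [s] o [pr]. *)
Section Idempotent.
Variables (R : comPzRingType) (P : lmodType R) (E : 'M[R]_2).
Variables (pr : {linear 'cV[R]_2 -> P}) (s : {linear P -> 'cV[R]_2}).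
Hypotheses (prs : forall z, pr (s z) = z) (Es : forall c, E *m c = s (pr c)).

Lemma section_idempotent : E *m E = E.
Proof. by apply: mulmx_inj => c; rewrite -mulmxA !Es prs. Qed.

Lemma rank1_local_outer (p : prime_ideal R) : has_rank P 1 ->
  exists2 u, u \notin p &
    exists (l : 'M[R]_(2, 1)) (o : 'M[R]_(1, 2)), u *: E = l *m o.
Proof.
move=> /(_ p) /rank1_local_generator[g gP].
have [u0 pu0 [a ea]] := gP (pr (delta_mx 0 0)).
have [u1 pu1 [b eb]] := gP (pr (delta_mx 1 0)).
exists (u0 * u1); first exact: (rpredM (s := prime_compl p)).
exists (s g), (\row_j if j == 0 then u1 * a else u0 * b).
apply/matrixP=> i j; rewrite outerE !mxE.
have Ec k : E i k = s (pr (delta_mx k 0)) i 0 by rewrite -Es -colE mxE.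
move: j; apply: ord2P; rewrite Ec /=.
  have /matrixP/(_ i 0) := congr1 s ea; rewrite !linearZ !mxE => e.
  by transitivity (u1 * (u0 * s (pr (delta_mx 0 0)) i 0)); [|rewrite e]; ring.
have /matrixP/(_ i 0) := congr1 s eb; rewrite !linearZ !mxE => e.
by transitivity (u0 * (u1 * s (pr (delta_mx 1 0)) i 0)); [|rewrite e]; ring.
Qed.

Lemma rank1_det0 : has_rank P 1 -> \det E = 0.
Proof.
move=> rk; apply: local_eq0 => p.
have [u pu [l [o e]]] := rank1_local_outer p rk.
exists (u ^+ 2); first exact: (rpredM (s := prime_compl p)).
by rewrite -detZ e det2E !outerE; ring.
Qed.

(** Locally u E = l o is an outer product, whose square is (o l) u E with o l its
    trace; as E is idempotent, u^2 (1 - tr E) kills E, hence P, and P is locally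
    faithful. *)
Lemma rank1_trace1 : has_rank P 1 -> \tr E = 1.
Proof.
move=> rk; apply/eqP; rewrite eq_sym -subr_eq0; apply/eqP; apply: local_eq0 => p.
have [u pu [l [o e]]] := rank1_local_outer p rk.
have [z|v pv ve] := rank1_local_faithful (rk p) (r := u ^+ 2 * (1 - \tr E)).
  have rE : (u ^+ 2 * (1 - \tr E)) *: E = 0.
    have EE : (u *: E) *m (u *: E) = (u * u) *: E.
      by rewrite -scalemxAl -scalemxAr section_idempotent scalerA.
    have : (u *: E) *m (u *: E) = (u * \tr E) *: (u *: E).
      rewrite -mxtraceZ e trace_mul1 mulmxA -(mulmxA l o l).
      by rewrite [o *m l]mx11_scalar mul_mx_scalar -scalemxAl !mxE.
    rewrite EE scalerA => e2.
    rewrite (_ : _ * _ = u * u - u * \tr E * u); last by ring.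
    by rewrite scalerBl e2 subrr.
  have Esz : E *m s z = s z by rewrite Es prs.
  by rewrite -[z]prs -Esz -linearZ scalemxAl rE mul0mx raddf0.
exists (v * u ^+ 2); last by rewrite -mulrA.
by do 2?[apply: (rpredM (s := prime_compl p))].
Qed.

Lemma non_full_section_iso : \tr E = 1 -> non_full E -> lmod_iso P R^o.
Proof.
move=> E1 [l [o e]].
have ol : o *m l = 1%:M by rewrite [LHS]mx11_scalar -trace_mul1 -e E1.
have [|h hE] := @ext_linear _ P R^o (fun z => (o *m s z) 0 0).
  by move=> a x y; rewrite !linearP !mxE.
exists h; exists (fun r => pr (r *: l)) => [z|r]; rewrite hE.
  by rewrite -mul_mx_scalar -mx11_scalar mulmxA -e Es !prs.
by rewrite -Es e -scalemxAr -scalemxAr -mulmxA ol mulmx1 ol !mxE mulr1.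
Qed.

End Idempotent.

Lemma rank1_two_generated_free (R : comPzRingType) (P : lmodType R) :
  (forall A : 'M[R]_2, unimodular A -> \det A = 0 -> non_full A) ->
  projective P -> has_rank P 1 -> generated_by_two P -> lmod_iso P R^o.
Proof.
move=> nf Pproj rk [x [y xyP]].
have [|pr prE] := @ext_linear _ 'cV[R]_2 P (fun c => c 0 0 *: x + c 1 0 *: y).
  move=> a c d; rewrite !mxE !scalerDl !scalerDr !scalerA.
  by rewrite addrACA.
have pr_surj z : exists c, pr c = z.
  have [a [b ->]] := xyP z.
  by exists (\col_i if i == 0 then a else b); rewrite prE !mxE.
have idlin : linear (@id P) by [].
have [idl idlE] := ext_linear idlin.
have [s prs0] := Pproj _ _ pr idl pr_surj.
have prs z : pr (s z) = z by rewrite prs0 idlE.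
pose E : 'M[R]_2 := \matrix_(i, j) s (pr (delta_mx j 0)) i 0.
have Es c : E *m c = s (pr c).
  rewrite {2}(_ : c = \sum_j c j 0 *: delta_mx j 0).
    by rewrite !linear_sum /=; apply/matrixP => i j; rewrite !ord1 !mxE summxE;
      apply: eq_bigr => k _; rewrite !linearZ !mxE mulrC.
  by rewrite [LHS]matrix_sum_delta; apply: eq_bigr => i _; rewrite big_ord1.
have E1 := rank1_trace1 prs Es rk.
apply: (non_full_section_iso prs Es E1); apply: nf; last exact: (rank1_det0 Es rk).
by apply/trace_unimodular; exists 1%:M; rewrite mul1mx.
Qed.

(** * The image of a unimodular matrix of zero determinant *)

Section Image.
Variables (R : comPzRingType) (A : 'M[R]_2).
Hypotheses (uA : unimodular A) (A0 : \det A = 0).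

Lemma in_imA (c : 'cV_2) : A *m c \in in_im (lmap A).
Proof. by apply/asboolP; exists c. Qed.

(** If A N A = A, then N z is the coordinate vector of z in Im_A with respect to
    the columns of A. *)
Lemma im_dual_basis :
  exists l : 'I_2 -> {linear im (lmap A) -> R^o},
    forall z, z = \sum_i (l i z : R) *: ImElt (in_imA (delta_mx i 0)).
Proof.
have [N [ANA N1]] := unimodular_inner_inverse uA A0.
have lP (i : 'I_2) : exists l : {linear im (lmap A) -> R^o},
    l =1 (fun z => (N *m val z) i 0).
  by apply: ext_linear => a x y; rewrite !linearP !mxE.
exists (fun i => projT1 (cid (lP i))) => z; apply: val_inj.
rewrite linear_sum sum2E /=.
case: cid => l0 /= ->; case: cid => l1 /= ->.
transitivity (A *m (N *m val z)).
  by case: z => _ /= /asboolP[c <-] /=; rewrite !mulmxA ANA.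
set c := N *m _; rewrite -!linearZ -linearD /=; congr (_ *m _).
by apply/matrixP => i j; rewrite !ord1; move: i; apply: ord2P; rewrite !mxE /=; ring.
Qed.

Lemma im_projective : projective (im (lmap A)).
Proof. by case: im_dual_basis => l /dual_basis_projective. Qed.

Lemma im_generated_by_two : generated_by_two (im (lmap A)).
Proof.
case: im_dual_basis => l lP; exists (ImElt (in_imA (delta_mx 0 0))).
exists (ImElt (in_imA (delta_mx 1 0))) => z.
by exists (l 0 z), (l 1 z); rewrite {1}[z]lP sum2E.
Qed.

Lemma unimodular_prime (p : prime_ideal R) : exists i j, A i j \notin p.
Proof.
apply: contrapT => Ap.
have {}Ap i j : A i j \in p.
  by apply: contrapT => /negP pij; apply: Ap; exists i, j.
case: uA => C; rewrite !sum2E => e.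
case: p Ap => p p0 pD pM p1 pP /= Ap; move/negP: p1; apply.
by rewrite -[X in X \in _]e; do 2!apply: (pD); apply: (pM).
Qed.

(** For A i j outside p, the identity A i j A = (column j of A) (row i of A) shows
    that the j-th column generates Im_A locally. *)
Lemma im_rank1 : has_rank (im (lmap A)) 1.
Proof.
move=> p; have [i [j pij]] := unimodular_prime p.
have [|l lE] := @ext_linear _ (im (lmap A)) R^o (fun z => val z i 0).
  by move=> a x y; rewrite linearP !mxE.
apply: (@localized_free1 _ (prime_compl p) (im (lmap A))
  (ImElt (in_imA (delta_mx j 0))) l (A i j)) => //.
  by rewrite lE /= -colE mxE.
move=> z; rewrite lE; apply: val_inj; rewrite !linearZ /=.
case: z => _ /= /asboolP[c <-] /=.
have trA : \tr (delta_mx j i *m A) = A i j.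
  by rewrite -(mul_delta_mx (0 : 'I_1)) -mulmxA trace_mul1 -rowE -colE !mxE.
rewrite scalemxAl -trA -det0_mul_mulmx // -(mul_delta_mx (0 : 'I_1)).
rewrite -!mulmxA mulmxA [X in _ *m X]mx11_scalar mul_mx_scalar.
by congr (_ *: _); rewrite -rowE mxE.
Qed.

End Image.

Theorem theorem1p4 (R : comPzRingType) :
  [<-> Pi2_ring R;
       forall A : 'M[R]_2, unimodular A -> \det A = 0 -> non_full A;
       forall A : 'M[R]_2, unimodular A -> \det A = 0 ->
         lmod_iso (ker (lmap A)) R^o \/ lmod_iso (im (lmap A)) R^o;
       forall P : lmodType R,
         projective P -> has_rank P 1 -> generated_by_two P -> lmod_iso P R^o]
  /\
  (forall A : 'M[R]_2, unimodular A -> \det A = 0 ->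
     (non_full A <-> factors_through_R (lmap A)))
  /\
  (forall A : 'M[R]_2, unimodular A -> \det A = 0 ->
     (lmod_iso (ker (lmap A)) R^o <-> lmod_iso (im (lmap A)) R^o)).
Proof.
have ext_nf (A : 'M[R]_2) : unimodular A -> \det A = 0 ->
    extendable A <-> non_full A.
  by move=> uA A0; rewrite extendableP // non_fullP.
split; last split.
- tfae.
  + by move=> Pi2 A uA A0; apply/ext_nf => //; apply: Pi2.
  + by move=> nf A uA A0; right; apply/non_full_im => //; apply: nf.
  + move=> kiso P; apply: rank1_two_generated_free => A uA A0.
    by have [/non_full_ker | /non_full_im] := kiso A uA A0; apply.
  + move=> free A uA A0; apply/ext_nf => //; apply/non_full_im => //.
    apply: free; first exact: im_projective.
      exact: im_rank1.
    exact: im_generated_by_two.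
- by move=> A _ _; apply: non_full_factors.
by move=> A uA A0; rewrite -non_full_ker // -non_full_im.
Qed.
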